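(* For every integer $r \geq 3$ and every $\alpha>0$, there exists $C=C(r,\alpha)>0$ such that for every $\varepsilon>0$, \[ \delta\left(\varepsilon,K_r;\frac{2r-5}{2r-3}- \alpha\right) \leq \delta (C\varepsilon, K_3). \] In particular, for every fixed $\gamma<\frac{2r-5}{2r-3}$, $\delta(\varepsilon, K_r; \gamma)^{-1}$ is super-polynomial in $\varepsilon^{-1}$ (i.e. there is no $\mu>0$ with $\delta(\varepsilon,K_r;\gamma)\geq \mu\varepsilon^{1/\mu}$ for all $\varepsilon\in(0,1)$).
   Context: For a graph $H$ on $h$ vertices, $\varepsilon>0$ and real $\gamma$, $\delta(\varepsilon,H;\gamma)$ denotes the maximum $\delta\in[0,1]$ such that, for every $n$, every $n$-vertex graph with fewer than $\delta n^h$ copies of $H$ (subgraphs isomorphic to $H$) and minimum degree at least $\gamma n$ can be made $H$-free by deleting at most $\varepsilon n^2$ edges. Also $\delta(\varepsilon,H)=\delta(\varepsilon,H;0)$ (no minimum degree condition). $K_r$ is the complete graph on $r$ vertices. *)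

(* Defs.v *)
From HB Require Import structures.
From mathcomp Require Import all_boot all_order all_algebra.
From mathcomp Require Import all_classical all_reals all_analysis.

Set Implicit Arguments.
Unset Strict Implicit.
Unset Printing Implicit Defensive.

Import Order.TTheory GRing.Theory Num.Theory.
Local Open Scope ring_scope.

(* Simple graphs on the vertex set T: an edge is a two-element set. *)
Record sgraph (T : finType) := SGraph {
  edges :> {set {set T}};
  edgesP : [forall e in edges, #|e| == 2%N]
}.

Definition degree (T : finType) (G : sgraph T) (v : T) : nat :=
  #|[set w | [set v; w] \in edges G]|.

Lemma del_edges_subproof (T : finType) (G : sgraph T) (D : {set {set T}}) :
  [forall e in edges G :\: D, #|e| == 2%N].
Proof.
apply/forall_inP => e; rewrite inE => /andP[_ eG].
exact: (forall_inP (edgesP G)).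
Qed.

Definition del_edges (T : finType) (G : sgraph T) (D : {set {set T}}) :
    sgraph T :=
  SGraph (del_edges_subproof G D).

Lemma complete_graph_subproof (r : nat) :
  [forall e in [set e : {set 'I_r} | #|e| == 2%N], #|e| == 2%N].
Proof. by apply/forall_inP => e; rewrite inE. Qed.

Definition complete_graph (r : nat) : sgraph 'I_r :=
  SGraph (complete_graph_subproof r).

(* A subgraph of G is a pair of a vertex set and an edge set, so that H may
   have isolated vertices and each subgraph is counted once, regardless of the
   number of isomorphisms from H onto it. *)
Definition copies (U T : finType) (H : sgraph U) (G : sgraph T) :
    {set {set T} * {set {set T}}} :=
  [set S : {set T} * {set {set T}} | (S.2 \subset edges G) &&
    [exists f : {ffun U -> T},
       [&& injectiveb f, S.1 == f @: [set: U] &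
           S.2 == [set f @: (e : {set U}) | e in edges H]]]].

Definition is_free (U T : finType) (H : sgraph U) (G : sgraph T) : Prop :=
  copies H G = finset.set0.

Definition removal (R : realType) (eps : R) (h : nat) (H : sgraph 'I_h)
    (gamma delta : R) : Prop :=
  forall (n : nat) (G : sgraph 'I_n),
    #|copies H G|%:R < delta * n%:R ^+ h ->
    (forall v : 'I_n, gamma * n%:R <= (degree G v)%:R) ->
    exists D : {set {set 'I_n}},
      [/\ D \subset edges G, #|D|%:R <= eps * n%:R ^+ 2
        & is_free H (del_edges G D)].

Definition removal_set (R : realType) (eps : R) (h : nat) (H : sgraph 'I_h)
    (gamma : R) : set R :=
  [set d : R | 0 <= d <= 1 /\ removal eps H gamma d]%classic.

Definition delta_deg (R : realType) (eps : R) (h : nat) (H : sgraph 'I_h)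
    (gamma : R) : R :=
  sup (removal_set eps H gamma).

Definition delta (R : realType) (eps : R) (h : nat) (H : sgraph 'I_h) : R :=
  delta_deg eps H 0.

Lemma removal_set0 (R : realType) (eps : R) (h : nat) (H : sgraph 'I_h)
  (gamma : R) : removal_set eps H gamma 0.
Proof. by split=> [|n G]; rewrite ?lexx ?ler01 // mul0r ltNge ler0n. Qed.

(* The supremum is attained: delta_deg is the maximum of removal_set. *)
Lemma delta_deg_max (R : realType) (eps : R) (h : nat) (H : sgraph 'I_h)
    (gamma : R) :
  removal_set eps H gamma (delta_deg eps H gamma) /\
  (forall d : R, removal_set eps H gamma d -> d <= delta_deg eps H gamma).
Proof.
set A := removal_set eps H gamma.
have A0 : A 0 by exact: removal_set0.
have ubA : ubound A 1 by move=> d [/andP[]].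
have supA : has_sup A by split; [exists 0 | exists 1].
have le_sup d : A d -> d <= sup A by apply: sup_upper_bound.
split=> //; split.
  by rewrite /delta_deg -/A le_sup //= ge_sup //; exists 0.
move=> n G copG degG.
have np : 0 < n%:R ^+ h :> R.
  rewrite lt_def exprn_ge0 // andbT; apply/eqP => n0.
  by move: copG; rewrite n0 mulr0 ltNge ler0n.
have lt_sup : #|copies H G|%:R / n%:R ^+ h < delta_deg eps H gamma.
  by rewrite ltr_pdivrMr.
have [d [_ dok] lt_d] := sup_gt (ex_intro _ 0 A0) lt_sup.
by apply: dok => //; rewrite -ltr_pdivrMr.
Qed.

(* Main.v *)
(* Part 1 blows up a graph G0 on n vertices by a variant of Hajnal's
   construction.  Take the tripartite double cover X, Y, Z of G0, add
   independent sets A1, A2, B of size p = K n, join A1 and A2 to B, X to A1,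
   Y to A2 and Z to B, and join the result completely to r - 3 further
   independent sets of size 2p.  The minimum degree is at least (2r-5)p out of
   (2r-3)p + 3n vertices, every K_r arises from a triangle of G0, and making the
   graph K_r-free costs at least a constant times what making G0 triangle-free
   costs.

   Part 2 combines this with a super-polynomial upper bound on delta(eps, K_3),
   from the Ruzsa-Szemeredi graph of Behrend's progression-free subset of
   (Z/2m)^d.  With d fixed and m -> oo this gives eps of order m^-2 and delta at
   most m^-d, and d is arbitrary. *)
Require Import Defs.
From HB Require Import structures.
From mathcomp Require Import all_boot all_order all_algebra.
From mathcomp Require Import all_classical all_reals all_analysis.
From mathcomp Require Import finset zify.
From mathcomp Require Import ring lra.

Set Implicit Arguments.
Unset Strict Implicit.
Unset Printing Implicit Defensive.

Import Order.TTheory GRing.Theory Num.Theory.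

(** * Counting bounds for finite sets *)

(** A witness determines its object, so choosing one witness per object is injective. Sizes of
    deletion sets are compared this way. *)
Lemma leq_card_rel (T U : finType) (Q : {set T}) (D : {set U})
    (R : T -> U -> Prop) :
  (forall q, q \in Q -> exists2 d, d \in D & R q d) ->
  (forall q q' d, R q d -> R q' d -> q = q') -> #|Q| <= #|D|.
Proof.
move=> QD Rinj.
pose g q := [pick d | `[< d \in D /\ R q d >]].
have gP q : q \in Q -> exists2 d, g q = Some d & d \in D /\ R q d.
  move=> /QD[d dD Rqd]; rewrite /g; case: pickP => [d' /asboolP|/(_ d)].
    by exists d'.
  by move=> /asboolP[].
rewrite -(card_in_imset (f := g) (D := Q)); last first.
  move=> q q' /gP[d -> [_ Rd]] /gP[d' -> [_ Rd']] [dd'].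
  by apply: Rinj Rd _; rewrite dd'.
rewrite -(card_imset (mem D) (@Some_inj _ : injective (@Some U))).
apply/subset_leq_card/fintype.subsetP => _ /imsetP[q /gP[d gd [dD _]] ->].
by rewrite gd imset_f.
Qed.

Lemma card_bigcup_leq (I T : finType) (B : {set I}) (F : I -> {set T}) k :
  (forall i, i \in B -> #|F i| <= k) -> #|\bigcup_(i in B) F i| <= #|B| * k.
Proof.
move=> Fk; rewrite -sum_nat_const.
apply: (@leq_trans (\sum_(i in B) #|F i|)); last exact: leq_sum.
elim/big_rec2: _ => [|i m A _ IH]; first by rewrite cards0.
by rewrite (leq_trans (leq_card_setU _ _)) // leq_add2l.
Qed.

(** * Cliques of relations and copies of complete graphs *)

(** Relations on arbitrary finite types let sum and product types serve directly as vertex sets of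
    the constructed graphs. *)
Definition cliques (T : finType) (r : nat) (e : rel T) : {set {set T}} :=
  [set S : {set T} | (#|S| == r) &&
     [forall x in S, forall y in S, (x != y) ==> e x y]].

(* D is a set of ordered pairs, so that an edge is destroyed as soon as one of
   its two orientations lies in D. *)
Definition del (T : finType) (e : rel T) (D : {set T * T}) : rel T :=
  [rel x y | e x y && ((x, y) \notin D)].

Lemma cliquesP (T : finType) (r : nat) (e : rel T) (S : {set T}) :
  reflect (#|S| = r /\ {in S &, forall x y, x != y -> e x y})
          (S \in cliques r e).
Proof.
rewrite inE; apply: (iffP andP) => -[/eqP Sr Se]; split=> //.
  by move=> x y xS yS; have /forall_inP/(_ y yS)/implyP := forall_inP Se x xS.
by apply/forall_inP=> x xS; apply/forall_inP=> y yS; apply/implyP; exact: Se.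
Qed.

Lemma cliques_imset (T U : finType) (f : T -> U) (r : nat) (e : rel T)
    (e' : rel U) (S : {set T}) :
  injective f -> (forall x y, e x y -> e' (f x) (f y)) ->
  S \in cliques r e -> f @: S \in cliques r e'.
Proof.
move=> finj fe /cliquesP[Sr Se]; apply/cliquesP; split.
  by rewrite card_imset.
move=> _ _ /imsetP[x xS ->] /imsetP[y yS ->]; rewrite (inj_eq finj) => xy.
exact/fe/Se.
Qed.

Lemma cliques_sub (T : finType) (r : nat) (e : rel T) (S S' : {set T}) :
  S \in cliques r e -> S' \subset S -> S' \in cliques #|S'| e.
Proof.
move=> /cliquesP[_ Se] /fintype.subsetP S'S; apply/cliquesP; split=> // x y xS yS.
by apply: Se; apply: S'S.
Qed.

Definition adj (T : finType) (G : sgraph T) : rel T :=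
  [rel x y | [set x; y] \in edges G].

Lemma edges_complete_imset (T : finType) (r : nat) (f : 'I_r -> T) :
  injective f ->
  [set f @: (e : {set 'I_r}) | e in edges (complete_graph r)] =
  [set e : {set T} | (e \subset f @: [set: 'I_r]) && (#|e| == 2)].
Proof.
move=> finj; apply/setP => e; rewrite inE; apply/imsetP/andP.
  move=> [e' /[!inE] /eqP e'2 ->]; rewrite card_imset // e'2.
  by split=> //; apply: imsetS; exact: subsetT.
move=> [eS e2]; have ee : e = f @: (f @^-1: e).
  apply/setP => x; apply/idP/imsetP => [xe|[y /[!inE] ye -> //]].
  have /imsetP[y _ xy] := fintype.subsetP eS x xe.
  by exists y; rewrite // inE -xy.
by exists (f @^-1: e); rewrite // inE -(card_imset _ finj) -ee.
Qed.

(** The image of ['I_r] carries all its two-element subsets as edges, so a copy is determined by its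
    vertex set; conversely, enumerating a clique gives the embedding. *)
Lemma copies_complete (T : finType) (r : nat) (G : sgraph T) :
  copies (complete_graph r) G =
  [set (S, [set e : {set T} | (e \subset S) && (#|e| == 2)])
    | S : {set T} in cliques r (adj G)].
Proof.
apply/setP=> -[S E]; rewrite inE /=; apply/andP/imsetP.
  move=> [EG /existsP[f /and3P[/injectiveP finj /eqP Sf /eqP Ef]]].
  exists S; last by rewrite Ef edges_complete_imset // -Sf.
  apply/cliquesP; split; first by rewrite Sf card_imset // cardsT card_ord.
  move=> x y xS yS xy; apply: (fintype.subsetP EG).
  rewrite Ef edges_complete_imset // -Sf inE cards2 xy andbT.
  by apply/fintype.subsetP => z /set2P[->|->].
move=> [S' /cliquesP[S'r S'e] [-> ->]]; split.
  apply/fintype.subsetP => e; rewrite inE => /andP[eS' /cards2P[x [y [xy exy]]]].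
  have eS z : z \in e -> z \in S' by apply: (fintype.subsetP eS').
  by rewrite exy; apply: S'e => //; apply: eS; rewrite exy !inE eqxx ?orbT.
pose f : 'I_r -> T := fun i => enum_val (cast_ord (esym S'r) i).
have finj : injective f by move=> i j /enum_val_inj/cast_ord_inj.
have fS : f @: [set: 'I_r] = S'.
  apply/eqP; rewrite eqEcard card_imset // cardsT card_ord S'r leqnn andbT.
  by apply/fintype.subsetP => _ /imsetP[i _ ->]; exact: enum_valP.
have fE : finfun f =1 f by move=> i; rewrite ffunE.
apply/existsP; exists (finfun f); apply/and3P; split.
- by apply/injectiveP; apply: eq_inj finj _ => i; rewrite ffunE.
- by rewrite -fS; apply/eqP; apply: eq_imset => i; rewrite ffunE.
rewrite -fS -edges_complete_imset //; apply/eqP.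
by apply: eq_in_imset => e _; apply: eq_imset => i; rewrite ffunE.
Qed.

Lemma card_copies_complete (T : finType) (r : nat) (G : sgraph T) :
  #|copies (complete_graph r) G| = #|cliques r (adj G)|.
Proof. by rewrite copies_complete card_imset // => S S' []. Qed.

Lemma is_free_complete (T : finType) (r : nat) (G : sgraph T) :
  is_free (complete_graph r) G <-> cliques r (adj G) = set0.
Proof.
rewrite /is_free; split=> /eqP; rewrite -cards_eq0.
  by rewrite card_copies_complete => /eqP/cards0_eq.
by rewrite -card_copies_complete => /eqP/cards0_eq.
Qed.

Lemma sgraph_of_subproof (T : finType) (e : rel T) :
  [forall E in [set E : {set T} | [exists x, exists y,
     [&& x != y, e x y & E == [set x; y]]]], #|E| == 2].
Proof.
apply/forall_inP => E; rewrite inE => /existsP[x /existsP[y /and3P[xy _ /eqP->]]].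
by rewrite cards2 xy.
Qed.

Definition sgraph_of (T : finType) (e : rel T) : sgraph T :=
  SGraph (sgraph_of_subproof e).

Lemma adj_sgraph_of (T : finType) (e : rel T) :
  symmetric e -> irreflexive e -> adj (sgraph_of e) =2 e.
Proof.
move=> esym eirr x y; rewrite /adj /= inE; apply/existsP/idP.
  move=> [x' /existsP[y' /and3P[xy' exy /eqP E]]].
  have : x' \in [set x; y] by rewrite E !inE eqxx.
  have : y' \in [set x; y] by rewrite E !inE eqxx orbT.
  have x1 : x \in [set x'; y'] by rewrite -E !inE eqxx.
  have y1 : y \in [set x'; y'] by rewrite -E !inE eqxx orbT.
  move: x1 y1 => /set2P[]-> /set2P[]-> //.
  - by rewrite setUid => /set1P xx; rewrite xx eqxx in xy'.
  - by rewrite esym.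
  - by move=> _; rewrite setUid => /set1P xx; rewrite xx eqxx in xy'.
move=> exy; exists x; apply/existsP; exists y; rewrite exy eqxx !andbT.
by apply/eqP => xy; rewrite xy eirr in exy.
Qed.

Lemma eq_cliques (T : finType) (r : nat) (e e' : rel T) :
  e =2 e' -> cliques r e = cliques r e'.
Proof.
move=> ee; apply/setP => S.
by apply/cliquesP/cliquesP => -[Sr Se]; split=> // x y xS yS xy;
  [rewrite -ee | rewrite ee]; exact: Se.
Qed.

Lemma adj_sym (T : finType) (G : sgraph T) : symmetric (adj G).
Proof. by move=> x y; rewrite /adj /= setUC. Qed.

Lemma adj_irr (T : finType) (G : sgraph T) : irreflexive (adj G).
Proof.
move=> x; apply/negP; rewrite /adj /= setUid => xG.
by have := forall_inP (edgesP G) _ xG; rewrite cards1.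
Qed.

Lemma cliques_neq (T : finType) (r : nat) (e : rel T) (S : {set T}) (x : T) :
  1 < r -> S \in cliques r e -> x \in S -> exists y, [/\ y \in S, y != x & e x y].
Proof.
move=> r1 /cliquesP[Sr Se] xS.
have : 0 < #|S :\ x| by move: Sr; rewrite (cardsD1 x) xS; lia.
case/card_gt0P => y /[!inE] /andP[yx yS]; exists y; split=> //.
by apply: Se; rewrite // eq_sym.
Qed.

Lemma cliquesS0 (T : finType) (r : nat) (e : rel T) :
  cliques r e = set0 -> cliques r.+1 e = set0.
Proof.
move=> e0; apply/eqP; rewrite -subset0; apply/fintype.subsetP => S Scl.
have [Sr _] := cliquesP _ _ _ Scl.
have /card_gt0P[x xS] : 0 < #|S| by rewrite Sr.
have := cliques_sub Scl (subsetDl S [set x]).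
have -> : #|S :\ x| = r by move: Sr; rewrite (cardsD1 x) xS; lia.
by rewrite e0 !inE.
Qed.

(** * Complete joins with an independent set *)

(* The graph e joined completely to an independent set W. *)
Definition join_rel (T : finType) (e : rel T) (W : finType) : rel (T + W) :=
  fun x y => match x, y with
  | inl x, inl y => e x y
  | inr _, inr _ => false
  | _, _ => true
  end.
Arguments join_rel {T} e W x y.

(** Distinct vertices of [W] are never adjacent, so a clique holds at most one of them. *)
Lemma join_cliques (T : finType) (e : rel T) (W : finType) (r : nat)
    (S : {set T + W}) :
  S \in cliques r (join_rel e W) ->
  S \in [set inl @: S0 | S0 : {set T} in cliques r e] \/
  0 < r /\ S \in [set inr q.2 |: inl @: q.1
                 | q : ({set T} * W)%type in setX (cliques r.-1 e) [set: W]].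
Proof.
move=> /cliquesP[Sr Se]; pose S0 := [set x | inl x \in S].
have S0cl : S0 \in cliques #|S0| e.
  apply/cliquesP; split=> // x y; rewrite !inE => xS yS xy.
  exact: (Se (inl x) (inl y)).
have inl_inj : injective (@inl T W) by move=> x y [].
have [/existsP[w wS]|] := boolP [exists w, inr w \in S].
  have SE : S = inr w |: inl @: S0.
    apply/setP => -[x|w']; rewrite !inE /=; first by rewrite mem_imset // inE.
    have -> : (inr w' \in [set inl x | x in S0]) = false.
      by apply/negP => /imsetP[].
    rewrite orbF; apply/idP/eqP => [w'S|[->] //].
    by apply/eqP/negPn/negP => ww; have := Se _ _ w'S wS ww.
  have rS : r = #|S0|.+1.
    rewrite -Sr SE cardsU1 card_imset // -[in RHS]add1n; congr (_ + _).
    by apply/eqP; rewrite eqb1; apply/negP => /imsetP[].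
  right; rewrite rS; split=> //; apply/imsetP; exists (S0, w) => //.
  by rewrite in_setX /= S0cl inE.
move=> /existsPn noW.
have SE : S = inl @: S0.
  apply/setP => -[x|w]; first by rewrite mem_imset // inE.
  by rewrite (negbTE (noW w)); apply/esym/negP => /imsetP[].
left; apply/imsetP; exists S0 => //.
by rewrite -Sr SE card_imset.
Qed.

Lemma card_join_cliques (T : finType) (e : rel T) (W : finType) (r : nat) :
  cliques r.+1 e = set0 ->
  #|cliques r.+1 (join_rel e W)| <= #|cliques r e| * #|W|.
Proof.
move=> e0; rewrite -cardsT -cardsX; apply: leq_trans (leq_imset_card _ _).
apply/subset_leq_card/fintype.subsetP => S /join_cliques[/imsetP[S0]|[_]].
  by rewrite e0 inE.
exact.
Qed.

Lemma join_cliques0 (T : finType) (e : rel T) (W : finType) (r : nat) :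
  cliques r e = set0 -> cliques r.+1 (join_rel e W) = set0.
Proof.
move=> e0; apply/eqP; rewrite -subset0; apply/fintype.subsetP => S.
move=> /join_cliques[/imsetP[S0]|[_ /imsetP[[S0 w]]]].
  by rewrite cliquesS0 // inE.
by rewrite inE /= e0 inE.
Qed.

(* Some w in W meets few pairs of D; deleting from T also all pairs that start
   at a D-neighbour of w lets w extend every surviving clique. *)
Lemma join_del (T : finType) (e : rel T) (W : finType) (r : nat)
    (D : {set (T + W) * (T + W)}) :
  1 < r -> 0 < #|W| -> cliques r.+1 (del (join_rel e W) D) = set0 ->
  exists D' : {set T * T}, cliques r (del e D') = set0 /\
    #|W| * #|D'| <= #|W| * #|D| + 2 * #|D| * #|T|.
Proof.
move=> r1 W0 free.
pose B w := [set x : T | ((inl x, inr w) \in D) || ((inr w, inl x) \in D)].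
(* The sum counts the pairs of [T * W] that lie in [D] in one of the two orders; each order
   contributes at most [#|D|]. *)
have sumB : \sum_(w : W) #|B w| <= 2 * #|D|.
  pose Q1 := [set q : T * W | (inl q.1, inr q.2) \in D].
  pose Q2 := [set q : T * W | (inr q.2, inl q.1) \in D].
  have Q1D : #|Q1| <= #|D|.
    apply: (leq_card_rel (R := fun q d => d = (inl q.1, inr q.2))).
      by move=> q; rewrite inE => qD; eexists; [exact: qD|].
    by move=> [x w] [x' w'] d /= -> [-> ->].
  have Q2D : #|Q2| <= #|D|.
    apply: (leq_card_rel (R := fun q d => d = (inr q.2, inl q.1))).
      by move=> q; rewrite inE => qD; eexists; [exact: qD|].
    by move=> [x w] [x' w'] d /= -> [-> ->].
  apply: (@leq_trans #|Q1 :|: Q2|); last first.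
    by rewrite (leq_trans (leq_card_setU _ _)) // mul2n -addnn leq_add.
  rewrite -sum1_card (partition_big snd predT) //=; apply: leq_sum => w _.
  rewrite -(card_imset _ (_ : injective (fun x : T => (x, w)))); last first.
    by move=> x y [].
  rewrite -sum1_card; apply: eq_leq; apply: eq_bigl => -[x w'].
  rewrite !inE /=.
  apply/imsetP/andP => [[y /[!inE] yB [-> ->]]|[xB /eqP ww]]; first by split.
  by exists x; rewrite -?ww ?inE.
have [w Bw] : exists w, #|W| * #|B w| <= 2 * #|D|.
  apply/existsP; apply: contraT => /existsPn Bbig.
  have : \sum_(w : W) (2 * #|D|).+1 <= \sum_(w : W) (#|W| * #|B w|).
    by apply: leq_sum => w _; rewrite ltnNge Bbig.
  rewrite sum_nat_const -big_distrr /= leq_pmul2l //.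
  by move=> /leq_trans/(_ sumB); rewrite ltnn.
pose D1 := [set q : T * T | (inl q.1, inl q.2) \in D].
exists (D1 :|: setX (B w) [set: T]); split; last first.
  have D1D : #|D1| <= #|D|.
    apply: (leq_card_rel (R := fun q d => d = (inl q.1, inl q.2))).
      by move=> q; rewrite inE => qD; eexists; [exact: qD|].
    by move=> [x y] [x' y'] d /= -> [-> ->].
  apply: (@leq_trans (#|W| * (#|D| + #|B w| * #|T|))).
    rewrite leq_pmul2l // (leq_trans (leq_card_setU _ _)) // leq_add //.
    by rewrite cardsX cardsT.
  by rewrite mulnDr leq_add2l mulnA leq_mul2r Bw orbT.
apply/eqP; rewrite -subset0; apply/fintype.subsetP => S Scl.
have [Sr Se] := cliquesP _ _ _ Scl.
(* As [1 < r], some surviving pair starts at [x], while every pair starting in [B w] was deleted. *)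
have SB x : x \in S -> x \notin B w.
  move=> xS; have [y [_ _ /andP[_]]] := cliques_neq r1 Scl xS.
  by rewrite !inE /= andbT negb_or => /andP[].
have inl_inj : injective (@inl T W) by move=> x y [].
suff : inr w |: inl @: S \in cliques r.+1 (del (join_rel e W) D).
  by rewrite free inE.
apply/cliquesP; split.
  rewrite cardsU1 card_imset // Sr -[in RHS]add1n; congr (_ + _).
  by apply/eqP; rewrite eqb1; apply/negP => /imsetP[].
move=> a b; rewrite !inE => /orP[/eqP->|/imsetP[x xS ->]] /orP[/eqP->|/imsetP[y yS ->]].
- by rewrite eqxx.
- by move=> _; rewrite /del /=; have := SB y yS; rewrite inE negb_or => /andP[_ ->].
- by move=> _; rewrite /del /=; have := SB x xS; rewrite inE negb_or => /andP[-> _].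
rewrite (inj_eq inl_inj) => xy; have /andP[/= exy ] := Se _ _ xS yS xy.
rewrite /del /= exy.
by rewrite !inE negb_or /= => /andP[-> _].
Qed.

(** * Hajnal's construction and the iterated blow-up *)

(* Hajnal's construction: 'I_3 * T0 carries the tripartite double cover of e0,
   and the class i is joined to the i-th class of 'I_3 * 'I_p, inside which
   class 2 is joined to classes 0 and 1. *)
Definition base_rel (T0 : finType) (e0 : rel T0) (p : nat) :
    rel ('I_3 * T0 + 'I_3 * 'I_p) :=
  fun x y => match x, y with
  | inl x, inl y => (x.1 != y.1) && e0 x.2 y.2
  | inr x, inr y => (x.1 == ord_max) (+) (y.1 == ord_max)
  | inl x, inr y => x.1 == y.1
  | inr x, inl y => x.1 == y.1
  end.
Arguments base_rel {T0} e0 p x y.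

(** No triangle meets ['I_3 * 'I_p]: adjacent vertices on the same side of the sum lie in different
    classes, so they have no common neighbour on the other side, and ['I_3 * 'I_p] itself is
    bipartite, class 2 against the rest. *)
Lemma base_triangle (T0 : finType) (e0 : rel T0) (p : nat) x y z :
  base_rel e0 p x y -> base_rel e0 p y z -> base_rel e0 p x z ->
  exists q, x = inl q.
Proof.
case: x y z => [x|x] [y|y] [z|z] /=; try by move=> *; eexists.
- by move=> /eqP-> /andP[/negbTE nyz _]; rewrite nyz.
- by move=> /eqP-> /eqP->; rewrite addbb.
- by move=> xy /eqP yz /eqP xz; move: xy; rewrite yz xz addbb.
by case: (x.1 == _); case: (y.1 == _); case: (z.1 == _).
Qed.

Lemma base_cliques_inl (T0 : finType) (e0 : rel T0) (p k : nat) S x :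
  2 < k -> S \in cliques k (base_rel e0 p) -> x \in S -> exists q, x = inl q.
Proof.
move=> k2 /cliquesP[Sk Se] xS.
have : 1 < #|S :\ x| by move: Sk; rewrite (cardsD1 x) xS; lia.
case/card_gt1P => y [z [/[!inE] /andP[yx yS] /andP[zx zS] yz]].
by apply: (@base_triangle _ e0 p x y z); apply: Se; rewrite // eq_sym.
Qed.

Lemma base_cliques4 (T0 : finType) (e0 : rel T0) (p : nat) :
  cliques 4 (base_rel e0 p) = set0.
Proof.
apply/eqP; rewrite -subset0; apply/fintype.subsetP => S Scl.
have [S4 Se] := cliquesP _ _ _ Scl.
pose c (x : 'I_3 * T0 + 'I_3 * 'I_p) :=
  match x with inl q => q.1 | inr q => q.1 end.
have : #|c @: S| <= 3 by apply: leq_trans (max_card _) _; rewrite card_ord.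
rewrite card_in_imset ?S4 // => x y xS yS.
have [[i v] xE] := base_cliques_inl (isT : 2 < 4) Scl xS.
have [[j w] yE] := base_cliques_inl (isT : 2 < 4) Scl yS.
move=> cxy; apply/eqP/negPn/negP => /(Se _ _ xS yS).
by move: cxy; rewrite xE yE /= => ->; rewrite eqxx.
Qed.

Lemma card_base_cliques (T0 : finType) (e0 : rel T0) (p : nat) :
  irreflexive e0 -> #|cliques 3 (base_rel e0 p)| <= #|cliques 3 e0| * 512.
Proof.
move=> e0irr.
(* A triangle projects to a triangle [S0] of [e0], irreflexivity keeping the three projections
   distinct. It lies among the nine points above [S0], which have [2 ^ 9 = 512] subsets. *)
pose F (S0 : {set T0}) : {set {set 'I_3 * T0 + 'I_3 * 'I_p}} :=
  powerset (inl @: setX [set: 'I_3] S0).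
apply: (@leq_trans #|\bigcup_(S0 in cliques 3 e0) F S0|); last first.
  apply: card_bigcup_leq => S0 /cliquesP[S0r _].
  by rewrite card_powerset card_imset ?cardsX ?cardsT ?card_ord ?S0r // => x y [].
apply/subset_leq_card/fintype.subsetP => S Scl.
have [S3 Se] := cliquesP _ _ _ Scl.
have Sinl x : x \in S -> exists q, x = inl q.
  exact: (base_cliques_inl (isT : 2 < 3) Scl).
pose S0 := [set v | [exists i, inl (i, v) \in S]].
apply/bigcupP; exists S0; last first.
  rewrite inE; apply/fintype.subsetP => x xS; have [[i v] xE] := Sinl x xS.
  rewrite xE imset_f // !inE /=; apply/existsP; exists i; by rewrite -xE.
apply/cliquesP; split; last first.
  move=> v w /[!inE] /existsP[i iS] /existsP[j jS] vw.
  have ne : inl (i, v) != inl (j, w) :> 'I_3 * T0 + 'I_3 * 'I_p.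
    by apply: contra vw => /eqP[_ ->].
  by have /andP[] := Se _ _ iS jS ne.
pose c (x : 'I_3 * T0 + 'I_3 * 'I_p) :=
  match x with inl q => Some q.2 | inr q => None end.
rewrite -S3 -(card_imset (mem S0) (@Some_inj _ : injective (@Some T0))).
rewrite -(card_in_imset (f := c) (D := S)).
  congr #|pred_of_set _|; apply/setP => o; apply/imsetP/imsetP => -[].
    by move=> v /[!inE] /existsP[i iS] ->; exists (inl (i, v)).
  move=> x xS ->; have [[i v] xE] := Sinl x xS; exists v; rewrite ?xE // inE.
  by apply/existsP; exists i; rewrite -xE.
move=> x y xS yS; have [[i v] xE] := Sinl x xS; have [[j w] yE] := Sinl y yS.
move=> cxy; apply/eqP/negPn/negP => /(Se _ _ xS yS).
by move: cxy; rewrite xE yE /= => -[->]; rewrite e0irr andbF.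
Qed.

(** [D0] is the projection of [D]. A triangle of [e0] surviving it lifts to the base with its [i]-th
    vertex in class [i], and no lifted pair is in [D]. *)
Lemma base_del (T0 : finType) (e0 : rel T0) (p : nat)
    (D : {set ('I_3 * T0 + 'I_3 * 'I_p) * ('I_3 * T0 + 'I_3 * 'I_p)}) :
  irreflexive e0 -> cliques 3 (del (base_rel e0 p) D) = set0 ->
  exists D0 : {set T0 * T0}, cliques 3 (del e0 D0) = set0 /\ #|D0| <= #|D|.
Proof.
move=> e0irr free.
exists [set q | [exists i, exists j, (inl (i, q.1), inl (j, q.2)) \in D]].
split; last first.
  apply: (leq_card_rel
    (R := fun q d => exists i j, d = (inl (i, q.1), inl (j, q.2)))).
    move=> q /[!inE] /existsP[i /existsP[j qD]].
    by eexists; [exact: qD | exists i, j].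
  by move=> [v w] [v' w'] d /= [i [j ->]] [i' [j' [_ -> _ ->]]].
apply/eqP; rewrite -subset0; apply/fintype.subsetP => S Scl.
have [S3 Se] := cliquesP _ _ _ Scl.
pose f (i : 'I_3) : T0 := enum_val (cast_ord (esym S3) i).
have finj : injective f by move=> i j /enum_val_inj/cast_ord_inj.
suff : [set inl (i, f i) | i : 'I_3] \in cliques 3 (del (base_rel e0 p) D).
  by rewrite free inE.
apply/cliquesP; split; first by rewrite card_imset ?card_ord // => i j [].
move=> _ _ /imsetP[i _ ->] /imsetP[j _ ->] ij.
have {}ij : i != j by apply: contra ij => /eqP->.
have := Se (f i) (f j) (enum_valP _) (enum_valP _).
rewrite (inj_eq finj) => /(_ ij) /andP[/= eij]; rewrite inE => nD.
rewrite /del /= ij eij /=.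
apply: contra nD => ijD.
by apply/existsP; exists i; apply/existsP; exists j.
Qed.

(* With k + 3 = r: (T, e) is a blow-up of (T0, e0) in which the copies of K_r
   come from triangles of e0 and cost at least 1/C as much to destroy. *)
Record blowup (k C p : nat) (T0 : finType) (e0 : rel T0) (T : finType)
    (e : rel T) : Prop := Blowup {
  blowup_sym : symmetric e;
  blowup_irr : irreflexive e;
  blowup_card : #|T| = 3 * #|T0| + (2 * k + 3) * p;
  blowup_deg : forall x, (2 * k + 1) * p <= #|[set y | e x y]|;
  blowup_few : #|cliques k.+3 e| <= #|cliques 3 e0| * 512 * (2 * p) ^ k;
  blowup_free : cliques k.+4 e = set0;
  blowup_del : forall D : {set T * T}, cliques k.+3 (del e D) = set0 ->
    exists D0 : {set T0 * T0},
      cliques 3 (del e0 D0) = set0 /\ #|D0| <= C * #|D| }.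

Lemma base_blowup (p : nat) (T0 : finType) (e0 : rel T0) :
  symmetric e0 -> irreflexive e0 -> blowup 0 1 p e0 (base_rel e0 p).
Proof.
move=> e0sym e0irr; split.
- by move=> [x|x] [y|y] /=; rewrite 1?eq_sym 1?e0sym // addbC.
- by move=> [x|x] /=; rewrite ?eqxx ?addbb.
- by rewrite card_sum !card_prod !card_ord.
(* Each vertex sees a whole class of size [p]: the one with its own index from the double cover,
   class 2 from classes 0 and 1, and class 0 from class 2. *)
- have few (i : 'I_3) (A : {set 'I_3 * T0 + 'I_3 * 'I_p}) :
    (forall q, inr (i, q) \in A) -> (2 * 0 + 1) * p <= #|A|.
    move=> iA; have pcard : #|[set: 'I_p]| = p by rewrite cardsT card_ord.
    rewrite mul1n -[X in X <= _]pcard.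
    pose g (q : 'I_p) : 'I_3 * T0 + 'I_3 * 'I_p := inr (i, q).
    have ginj : injective g by move=> q q' [].
    rewrite -(card_imset _ ginj).
    apply/subset_leq_card/fintype.subsetP => _ /imsetP[q _ ->]; exact: iA.
  move=> [[i v]|[i v]].
    by apply: (few i) => q; rewrite inE /= eqxx.
  apply: (few (if i == ord_max then ord0 else ord_max)) => q; rewrite inE /=.
  by case: eqP.
- by rewrite expn0 muln1 card_base_cliques.
- exact: base_cliques4.
by move=> D /(base_del e0irr); rewrite mul1n.
Qed.

(** The size [2 * p] raises every old degree by [2 * p], and a new vertex sees all of [T], at least
    [(2 * k + 3) * p] vertices; both meet the bound for [k.+1]. *)
Lemma join_blowup (k C p : nat) (T0 : finType) (e0 : rel T0) (T : finType)
    (e : rel T) :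
  0 < p -> #|T0| <= p -> blowup k C p e0 e ->
  blowup k.+1 (C * (2 * k + 7)) p e0 (join_rel e 'I_(2 * p)).
Proof.
move=> p0 T0p [e_sym e_irr cardT deg few free del_e]; split.
- by move=> [x|x] [y|y] /=.
- by move=> [x|x] /=.
- rewrite card_sum card_ord cardT; lia.
- move=> [x|w].
    have -> : [set y | join_rel e 'I_(2 * p) (inl x) y] =
        inl @: [set y | e x y] :|: inr @: [set: 'I_(2 * p)].
      apply/setP => -[y|y]; rewrite !inE /=.
        rewrite mem_imset ?inE; last by move=> u v [].
        by rewrite [X in _ || X](_ : _ = false) ?orbF //; apply/negP => /imsetP[].
      by apply/esym/orP; right; rewrite imset_f // inE.
    rewrite cardsU (_ : _ :&: _ = set0); last first.
      apply/setP => y; rewrite !inE; apply/negP => /andP[/imsetP[u _ ->]].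
      by case/imsetP.
    rewrite cards0 subn0 !card_imset; [|by move=> u v []..].
    rewrite cardsT card_ord; have := deg x; lia.
  have -> : [set y | join_rel e 'I_(2 * p) (inr w) y] = inl @: [set: T].
    apply/setP => -[y|y]; rewrite !inE /=; first by rewrite imset_f ?inE.
    by apply/esym/negP => /imsetP[].
  rewrite card_imset; last by move=> u v [].
  by rewrite cardsT cardT; lia.
- apply: leq_trans (card_join_cliques _ free) _.
  by rewrite card_ord expnSr [X in _ <= X]mulnA leq_mul2r few orbT.
- exact: join_cliques0.
move=> D /join_del[//||D' [/del_e[D0 [D0free D0D']]]]; first by rewrite card_ord; lia.
rewrite card_ord cardT => D'D; exists D0; split=> //.
apply: leq_trans D0D' _; rewrite -mulnA leq_mul2l; apply/orP; right.
(* [join_del] multiplies the cost by at most [1 + #|T| / p], and [#|T| <= (2 * k + 6) * p] since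
   [#|T0| <= p]; hence the factor [2 * k + 7]. *)
rewrite -(leq_pmul2l (_ : 0 < 2 * p)); last lia.
apply: leq_trans D'D _.
have : #|D| * #|T0| <= #|D| * p by rewrite leq_mul2l T0p orbT.
move: #|D| #|T0| => d t dtp; nia.
Qed.

(** Each join multiplies the constant by a factor depending on [k] alone, so [C] precedes [p] and
    the graph. *)
Lemma exists_blowup (k : nat) : exists2 C, 0 < C &
  forall (p : nat) (T0 : finType) (e0 : rel T0), symmetric e0 ->
    irreflexive e0 -> 0 < p -> #|T0| <= p ->
    exists (T : finType) (e : rel T), blowup k C p e0 e.
Proof.
elim: k => [|k [C C0 IH]].
  exists 1 => // p T0 e0 e0sym e0irr _ _.
  by eexists; exists (base_rel e0 p); exact: base_blowup.
exists (C * (2 * k + 7)) => [|p T0 e0 e0sym e0irr p0 T0p]; first lia.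
have [T [e eb]] := IH p T0 e0 e0sym e0irr p0 T0p.
by eexists; exists (join_rel e 'I_(2 * p)); exact: join_blowup.
Qed.

(** * Progression-free sets from spheres *)

(** The [m ^ d] digit vectors take at most [d * m ^ 2] values of the squared norm. *)
Lemma sphere_pigeonhole (d m : nat) : 0 < d -> 0 < m -> exists s,
  m ^ d <= d * m ^ 2 * #|[set a : {ffun 'I_d -> 'I_m} | \sum_j a j ^ 2 == s]|.
Proof.
move=> d0 m0.
have bound (a : {ffun 'I_d -> 'I_m}) : \sum_j a j ^ 2 < d * m ^ 2.
  apply: (@leq_ltn_trans (\sum_(j < d) m.-1 ^ 2)).
    by apply: leq_sum => j _; rewrite leq_exp2r // -ltnS prednK.
  by rewrite sum_nat_const card_ord ltn_pmul2l // ltn_exp2r // prednK.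
pose F (s : 'I_(d * m ^ 2)) :=
  #|[set a : {ffun 'I_d -> 'I_m} | \sum_j a j ^ 2 == s]|.
have sumF : \sum_s F s = m ^ d.
  have <- : #|{ffun 'I_d -> 'I_m}| = m ^ d by rewrite card_ffun !card_ord.
  rewrite -sum1_card.
  rewrite (partition_big (fun a => Ordinal (bound a)) predT) //=.
  by apply: eq_bigr => s _; rewrite /F -sum1dep_card.
have [s Fs] : exists s : 'I_(d * m ^ 2), m ^ d <= d * m ^ 2 * F s; last first.
  by exists (val s).
apply/existsP; apply: contraT => /existsPn small.
have dm0 : 0 < d * m ^ 2 by rewrite muln_gt0 d0 expn_gt0 m0.
have : \sum_(s < d * m ^ 2) (d * m ^ 2 * F s).+1 <= \sum_(s < d * m ^ 2) m ^ d.
  by apply: leq_sum => s _; rewrite ltnNge small.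
under eq_bigr do rewrite -addn1.
by rewrite big_split /= -big_distrr /= sumF !sum_nat_const card_ord muln1; lia.
Qed.

(** The progression is [a], [c], [b]. Allowing [b = a] makes doubling injective on [A] even in a
    group with 2-torsion, which [rs_edge_disjoint] relies on. *)
Definition ap_free (V : zmodType) (A : {pred V}) :=
  forall a b c, a \in A -> b \in A -> c \in A -> (a + b = c + c)%R -> a = c.

(* Behrend: the digits stay below half the modulus, so a 3-term progression
   in A is one in Z^d, where spheres contain none. *)
Lemma exists_ap_free (d m : nat) : 0 < d -> 0 < m ->
  exists2 A : {set 'rV['Z_(2 * m)]_d}, ap_free A & m ^ d <= d * m ^ 2 * #|A|.
Proof.
move=> d0 m0; have [s ms] := sphere_pigeonhole d0 m0.
have m1 : 1 < 2 * m by lia.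
pose f (a : {ffun 'I_d -> 'I_m}) : 'rV['Z_(2 * m)]_d := (\row_j (a j)%:R)%R.
have Zinj (x y : nat) : x < 2 * m -> y < 2 * m ->
    (x%:R = y%:R :> 'Z_(2 * m))%R -> x = y.
  by move=> xm ym /(congr1 val); rewrite /= !val_Zp_nat // !modn_small.
have finj : injective f.
  move=> a b /rowP fab; apply/ffunP => j; apply/val_inj.
  have := fab j; rewrite !mxE; apply: Zinj.
    by have := ltn_ord (a j); lia.
  by have := ltn_ord (b j); lia.
exists (f @: [set a : {ffun 'I_d -> 'I_m} | \sum_j a j ^ 2 == s]); last first.
  by rewrite card_imset.
move=> _ _ _ /imsetP[a /[!inE] /eqP sa ->] /imsetP[b /[!inE] /eqP sb ->]
  /imsetP[c /[!inE] /eqP sc ->] /rowP abc; congr f.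
have {}abc j : a j + b j = c j + c j.
  have := abc j; rewrite !mxE -!natrD; apply: Zinj.
    by rewrite mul2n -addnn -addSn leq_add // ltnW.
  by rewrite mul2n -addnn -addSn leq_add // ltnW.
(* With truncated subtraction, [t j] is the distance from [a j] to [c j]. As [c] is the midpoint,
   the parallelogram identity gives [sq]; summing over the sphere forces every [t j] to vanish. *)
pose t j := (a j - c j) + (c j - a j).
have sq j : a j ^ 2 + b j ^ 2 = c j ^ 2 + c j ^ 2 + 2 * t j ^ 2.
  by have := abc j; rewrite /t; case: (leqP (a j) (c j)) => ac abcj; nia.
have : \sum_j (a j ^ 2 + b j ^ 2) = \sum_j (c j ^ 2 + c j ^ 2 + 2 * t j ^ 2).
  by apply: eq_bigr => j _.
rewrite !big_split /= sa sb sc => /eqP.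
rewrite -[X in X == _]addn0 eqn_add2l eq_sym addn_eq0 => /andP[].
rewrite sum_nat_eq0 => /forallP t0 _; apply/ffunP => j; apply/val_inj.
by have := t0 j; rewrite /t expn_eq0 /= andbT => /eqP; lia.
Qed.

(** * The Ruzsa-Szemeredi graph of a progression-free set *)

Section RuzsaSzemeredi.
Variables (V : finZmodType) (A : {set V}).
Hypothesis apA : ap_free A.

(** The points [x], [x + a], [x + a + a] in the three copies of [V] form a line of slope [a]; edges
    join points on a common line with slope in [A]. Arcs go up in class because [v.1 - u.1] is
    truncated. *)
Definition rs_arc : rel ('I_3 * V) := fun u v =>
  (u.1 < v.1) && [exists a in A, v.2 == (u.2 + a *+ (v.1 - u.1))%R].

Definition rs_rel : rel ('I_3 * V) := fun u v => rs_arc u v || rs_arc v u.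

Definition rs_triangle (q : V * V) : {set 'I_3 * V} :=
  [set (i, (q.1 + q.2 *+ i)%R) | i : 'I_3].

Lemma rs_sym : symmetric rs_rel.
Proof. by move=> u v; rewrite /rs_rel orbC. Qed.

Lemma rs_irr : irreflexive rs_rel.
Proof. by move=> u; rewrite /rs_rel /rs_arc ltnn. Qed.

Lemma rs_arcP (i j : 'I_3) (x y : V) : i < j -> rs_rel (i, x) (j, y) ->
  exists2 a, a \in A & y = (x + a *+ (j - i))%R.
Proof.
rewrite /rs_rel /rs_arc /= => ij; rewrite ij [j < i]ltnNge (ltnW ij) /= orbF.
by move=> /exists_inP[a aA /eqP ->]; exists a.
Qed.

Lemma card_rs_triangle q : #|rs_triangle q| = 3.
Proof. by rewrite card_imset ?card_ord // => i j []. Qed.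

Lemma rs_triangle_clique q : q.2 \in A -> rs_triangle q \in cliques 3 rs_rel.
Proof.
move=> qA; apply/cliquesP; split; first exact: card_rs_triangle.
have arc (i j : 'I_3) : i < j ->
    rs_arc (i, q.1 + q.2 *+ i)%R (j, q.1 + q.2 *+ j)%R.
  move=> ij; rewrite /rs_arc /= ij /=; apply/exists_inP; exists q.2 => //.
  by rewrite -addrA -mulrnDr subnKC // ltnW.
move=> _ _ /imsetP[i _ ->] /imsetP[j _ ->] ne; rewrite /rs_rel.
case: (ltngtP i j) => [/arc->//|/arc->|/val_inj ij]; first by rewrite orbT.
by rewrite ij eqxx in ne.
Qed.

(** The sides between classes 0 and 1, 1 and 2, 0 and 2 have slopes with [a + b = c + c].
    Progression-freeness forces [a = c], so the triangle is a planted line. *)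
Lemma rs_cliques S : S \in cliques 3 rs_rel ->
  exists2 q, q.2 \in A & S = rs_triangle q.
Proof.
move=> /cliquesP[S3 Se].
have fstS : [set u.1 | u in S] = [set: 'I_3].
  apply/eqP; rewrite eqEcard subsetT cardsT card_ord card_in_imset ?S3 //.
  move=> u v uS vS uv; apply/eqP; apply: contraT => /(Se _ _ uS vS).
  by rewrite /rs_rel /rs_arc uv ltnn.
have ex i : exists x, (i, x) \in S.
  have : i \in [set u.1 | u in S] by rewrite fstS inE.
  by case/imsetP => -[j x] xS /= ->; exists x.
pose i1 : 'I_3 := Ordinal (isT : 1 < 3); pose i2 : 'I_3 := Ordinal (isT : 2 < 3).
have [x0 S0] := ex ord0; have [x1 S1] := ex i1; have [x2 S2] := ex i2.
have [a aA x1E] := rs_arcP (isT : ord0 < i1) (Se _ _ S0 S1 isT).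
have [b bA x2E] := rs_arcP (isT : i1 < i2) (Se _ _ S1 S2 isT).
have [c cA x2E'] := rs_arcP (isT : ord0 < i2) (Se _ _ S0 S2 isT).
rewrite /= !mulr1n in x1E x2E x2E'.
have abc : (a + b = c + c)%R.
  by apply: (addrI x0); rewrite addrA -x1E -x2E x2E' mulr2n.
have ac := apA aA bA cA abc.
exists (x0, a) => //; apply/esym/eqP; rewrite eqEcard card_rs_triangle S3 leqnn andbT.
apply/fintype.subsetP => _ /imsetP[[[|[|[|//]]] i3] _ ->] /=.
- by rewrite addr0 (_ : Ordinal i3 = ord0) //; apply: val_inj.
- by rewrite -x1E (_ : Ordinal i3 = i1) //; apply: val_inj.
- by rewrite ac -x2E' (_ : Ordinal i3 = i2) //; apply: val_inj.
Qed.

Lemma card_rs_cliques : #|cliques 3 rs_rel| <= #|V| ^ 2.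
Proof.
rewrite -mulnn -card_prod -cardsT.
apply: leq_trans (leq_imset_card rs_triangle _).
apply/subset_leq_card/fintype.subsetP => S /rs_cliques[q _ ->].
exact: imset_f.
Qed.

(** Two points of a line determine its slope: their difference is the slope times [j - i], which is
    1 or 2, and doubling is injective on [A]. *)
Lemma rs_edge_disjoint (q q' : V * V) (i j : 'I_3) : q.2 \in A -> q'.2 \in A ->
  i < j -> (q.1 + q.2 *+ i = q'.1 + q'.2 *+ i)%R ->
  (q.1 + q.2 *+ j = q'.1 + q'.2 *+ j)%R -> q = q'.
Proof.
move=> qA qA' ij ei ej.
have aa : (q.2 *+ (j - i) = q'.2 *+ (j - i))%R.
  apply: (addrI (q.1 + q.2 *+ i)%R); rewrite [in RHS]ei -!addrA -!mulrnDr.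
  by rewrite subnKC // ltnW.
have aE : q.2 = q'.2.
  have : j - i = 1 \/ j - i = 2 by have := ltn_ord j; lia.
  case=> jiE; first by move: aa; rewrite jiE.
  by apply: (apA qA qA qA'); rewrite -!mulr2n -jiE.
case: q q' aE ei {qA qA' aa ej} => [x a] [x' a'] /= -> /addIr -> //.
Qed.

(** The [#|V| * #|A|] planted triangles are pairwise edge-disjoint, and each must lose a pair to
    [D]. *)
Lemma rs_far (D : {set ('I_3 * V) * ('I_3 * V)}) :
  cliques 3 (del rs_rel D) = set0 -> #|V| * #|A| <= #|D|.
Proof.
move=> free; rewrite -cardsT -cardsX.
apply: (leq_card_rel (R := fun q d => [/\ q.2 \in A, d.1 != d.2,
  d.1 \in rs_triangle q & d.2 \in rs_triangle q])).
  move=> q; rewrite !inE /= => qA; apply: contrapT => none.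
  suff : rs_triangle q \in cliques 3 (del rs_rel D) by rewrite free inE.
  have /cliquesP[q3 qe] := rs_triangle_clique qA.
  apply/cliquesP; split=> // u v uq vq uv; rewrite /del /= qe //=.
  by apply/negP => uvD; apply: none; exists (u, v).
move=> q q' [u v] /= [qA uv /imsetP[i _ uE] /imsetP[j _ vE]].
move=> [qA' _ /imsetP[i' _ uE'] /imsetP[j' _ vE']].
have [ii' ei] : (i, q.1 + q.2 *+ i)%R = (i', q'.1 + q'.2 *+ i')%R by rewrite -uE.
have [jj' ej] : (j, q.1 + q.2 *+ j)%R = (j', q'.1 + q'.2 *+ j')%R by rewrite -vE.
rewrite -ii' in ei; rewrite -jj' in ej.
case: (ltngtP i j) => [ij|ij|/val_inj ij]; first exact: rs_edge_disjoint ij ei ej.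
  exact: rs_edge_disjoint ij ej ei.
by rewrite uE vE ij eqxx in uv.
Qed.

End RuzsaSzemeredi.

(** * Transfer of the removal property and the resulting bounds *)

Local Open Scope ring_scope.

(* Transfers the removal property from graphs on 'I_n to symmetric relations on
   an arbitrary finite type; 4 bounds the number of ordered pairs inside an
   edge. *)
Lemma removal_rel (R : realType) (eps gamma d : R) (r : nat) (T : finType)
    (e : rel T) :
  symmetric e -> irreflexive e ->
  removal eps (complete_graph r) gamma d ->
  #|cliques r e|%:R < d * #|T|%:R ^+ r ->
  (forall x, gamma * #|T|%:R <= #|[set y | e x y]|%:R) ->
  exists D : {set T * T},
    cliques r (del e D) = set0 /\ #|D|%:R <= 4 * (eps * #|T|%:R ^+ 2).
Proof.
move=> esym eirr rem cl deg.
pose f : 'I_#|T| -> T := enum_val.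
have finj : injective f := enum_val_inj.
pose e' := relpre f e; pose G := sgraph_of e'.
have adjG : adj G =2 e'.
  by apply: adj_sgraph_of => [x y|x]; [apply: esym | apply: eirr].
have [|v|D [DG Deps Dfree]] := rem _ G.
- rewrite card_copies_complete (eq_cliques _ adjG); apply: le_lt_trans cl.
  rewrite ler_nat -(card_imset _ (imset_inj finj)); apply: subset_leq_card.
  by apply/fintype.subsetP => _ /imsetP[S Se ->]; exact: (cliques_imset finj _ Se).
- apply: le_trans (deg (f v)) _; rewrite ler_nat /degree.
  rewrite -(card_imset _ finj); apply: subset_leq_card.
  apply/fintype.subsetP => y; rewrite inE => fvy; apply/imsetP.
  exists (enum_rank y); last by rewrite /f enum_rankK.
  by rewrite inE -[_ \in _]/(adj G v (enum_rank y)) adjG /e' /= /f enum_rankK.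
pose E := [set q : T * T | [set enum_rank q.1; enum_rank q.2] \in D].
exists E; split.
  apply/eqP; rewrite -subset0; apply/fintype.subsetP => S Scl.
  have : [set enum_rank x | x in S] \in cliques r (adj (del_edges G D)).
    apply: (cliques_imset enum_rank_inj _ Scl) => x y /andP[exy].
    rewrite /E inE /= => xyD; rewrite /adj /= !inE xyD /=.
    have := adjG (enum_rank x) (enum_rank y).
    by rewrite /adj /= inE => ->; rewrite /e' /= /f !enum_rankK.
  by move/is_free_complete: Dfree => ->; rewrite inE.
apply: (@le_trans _ _ (4 * #|D|%:R)); last by rewrite ler_pM2l.
rewrite -natrM ler_nat mulnC.
apply: (@leq_trans #|\bigcup_(s in D) setX (f @: s) (f @: s)|).
  apply/subset_leq_card/fintype.subsetP => -[x y]; rewrite inE /= => xyD.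
  apply/bigcupP; eexists; first exact: xyD.
  rewrite inE /= -(enum_rankK x) -(enum_rankK y).
  by rewrite !(imset_f f) // !enum_rankK !inE eqxx ?orbT.
apply: card_bigcup_leq => s sD; rewrite cardsX card_imset //.
have sG : s \in edges G by apply: (fintype.subsetP DG).
by have /eqP-> := forall_inP (edgesP G) s sG.
Qed.

(** The blow-up with [p = K * n] has [L * n] vertices. In the clique count, [8 <= L] absorbs
    [512 = 8 ^ 3] and [2 * K <= L] absorbs the power of [2 * p]. In the new parameter, 4 comes from
    [removal_rel], [C] from [blowup_del] and [L ^ 2] from the vertex count. *)
Lemma removal_triangle (R : realType) (eps gamma d : R) (k C K : nat) :
  (0 < C)%N -> (8 <= K)%N ->
  (forall (p : nat) (T0 : finType) (e0 : rel T0), symmetric e0 ->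
    irreflexive e0 -> (0 < p)%N -> (#|T0| <= p)%N ->
    exists (T : finType) (e : rel T), blowup k C p e0 e) ->
  gamma * (3 + (2 * k + 3) * K)%:R <= ((2 * k + 1) * K)%:R ->
  removal eps (complete_graph k.+3) gamma d ->
  removal (4 * C%:R * (3 + (2 * k + 3) * K)%:R ^+ 2 * eps) (complete_graph 3) 0 d.
Proof.
set L := (3 + (2 * k + 3) * K)%N => C0 K8 blow gammaL rem n G0 few _.
have n0 : (0 < n)%N.
  case: n G0 few => // G0; rewrite expr0n /= mulr0.
  by rewrite ltNge ler0n.
have d0 : 0 < d.
  have := le_lt_trans (ler0n R _) few.
  by rewrite pmulr_lgt0 // exprn_gt0 // ltr0n.
have [||T [e [e_sym e_irr cardT deg fewT _ del_e]]] :=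
  blow (K * n)%N _ (adj G0) (adj_sym G0) (adj_irr G0).
- by rewrite muln_gt0 n0; lia.
- by rewrite card_ord leq_pmull //; lia.
have {}cardT : #|T| = (n * L)%N.
  by rewrite cardT card_ord /L mulnDr (mulnC n 3%N) (mulnCA n) (mulnC n K).
have KL : (2 * K <= L)%N.
  by rewrite /L (leq_trans _ (leq_addl _ _)) // leq_mul2r; lia.
have [||D [Dfree Deps]] := removal_rel e_sym e_irr rem.
- apply: (@le_lt_trans _ _
    (#|cliques 3 (adj G0)|%:R * (512 * (2 * (K * n)) ^ k)%:R)).
    by rewrite -natrM ler_nat mulnA.
  rewrite -card_copies_complete.
  apply: (@lt_le_trans _ _ (d * n%:R ^+ 3 * (512 * (2 * (K * n)) ^ k)%:R)).
    have pos : (0 < 512 * (2 * (K * n)) ^ k)%N.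
      by rewrite muln_gt0 expn_gt0 !muln_gt0 n0 (leq_trans _ K8).
    move: (512 * _)%N pos => q q0.
    by rewrite ltr_pM2r // ltr0n.
  rewrite -mulrA ler_pM2l // cardT -natrX -natrM -natrX ler_nat.
  rewrite -[k.+3]/(3 + k)%N expnD mulnA.
  apply: leq_mul.
    by rewrite -(expnMn n 8 3) leq_exp2r // leq_mul2l; apply/orP; right; lia.
  have le_exp a b j : (a <= b -> a ^ j <= b ^ j)%N.
    by case: j => // j; rewrite leq_exp2r.
  by apply: le_exp; rewrite mulnA mulnC leq_mul2l KL orbT.
- move=> x; apply: (@le_trans _ _ ((2 * k + 1) * (K * n))%:R); last first.
    by rewrite ler_nat deg.
  rewrite cardT mulnA [in leRHS]natrM mulnC natrM mulrA.
  by rewrite ler_pM2r // ltr0n.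
have [D0 [D0free D0D]] := del_e D Dfree.
exists ([set [set q.1; q.2] | q in D0] :&: edges G0); split.
- exact: subsetIr.
- apply: (@le_trans _ _ #|D0|%:R).
    rewrite ler_nat; apply: leq_trans (leq_imset_card (fun q => [set q.1; q.2]) _).
    by apply: subset_leq_card; exact: subsetIl.
  apply: (@le_trans _ _ (C%:R * #|D|%:R)); first by rewrite -natrM ler_nat.
  apply: (@le_trans _ _ (C%:R * (4 * (eps * #|T|%:R ^+ 2)))).
    by rewrite ler_pM2l // ltr0n.
  rewrite cardT natrM exprMn le_eqVlt; apply/orP; left; apply/eqP; ring.
apply/is_free_complete/eqP; rewrite -subset0; apply/fintype.subsetP => S.
move=> /cliquesP[S3 Se]; rewrite -D0free; apply/cliquesP; split=> // x y xS yS xy.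
have := Se x y xS yS xy; rewrite /adj /= !inE negb_and andb_orl andNb orbF.
move=> /andP[xyD xyG]; rewrite /del /adj /= xyG /=; apply: contra xyD => xyD.
by apply/imsetP; exists (x, y).
Qed.

Lemma delta_deg_triangle (R : realType) (k : nat) (alpha : R) : 0 < alpha ->
  exists C : R, 0 < C /\ forall eps : R, 0 < eps ->
    delta_deg eps (complete_graph k.+3)
        ((2 * k.+3%:R - 5) / (2 * k.+3%:R - 3) - alpha)
      <= delta (C * eps) (complete_graph 3).
Proof.
move=> alpha0; have [C C0 blow] := exists_blowup k.
(* [1 <= alpha * K] pays for the [3 * n] vertices of the double cover: with [q] the threshold ratio,
   [3 * (q - alpha) <= 3 <= alpha * (2 * k + 3) * K], which is the degree condition. *)
have [K K8 Kalpha] : exists2 K, (8 <= K)%N & 1 <= alpha * K%:R.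
  exists (8 + Num.truncn alpha^-1)%N; first exact: leq_addr.
  rewrite -ler_pdivrMl // mulr1.
  apply: (@le_trans _ _ (Num.truncn alpha^-1).+1%:R); first exact/ltW/truncnS_gt.
  by rewrite ler_nat; lia.
exists (4 * C%:R * (3 + (2 * k + 3) * K)%:R ^+ 2); split.
  by rewrite !mulr_gt0 ?exprn_gt0 // ltr0n.
move=> eps eps0.
(* The supremum for the clique is attained, so it is itself an admissible value to transfer to
   triangles. *)
have [[d01 rem] _] := delta_deg_max eps (complete_graph k.+3)
  ((2 * k.+3%:R - 5) / (2 * k.+3%:R - 3) - alpha).
have [_ ub] := delta_deg_max (4 * C%:R * (3 + (2 * k + 3) * K)%:R ^+ 2 * eps)
  (complete_graph 3) 0.
apply: ub; split=> //; apply: removal_triangle rem => //.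
have -> : 2 * k.+3%:R - 5 = 2 * k%:R + 1 :> R by rewrite -[k.+3]addn3 natrD; ring.
have -> : 2 * k.+3%:R - 3 = 2 * k%:R + 3 :> R by rewrite -[k.+3]addn3 natrD; ring.
rewrite !(natrD, natrM).
have k0 : 0 <= k%:R :> R by [].
set q := _ / _; have qE : q * (2 * k%:R + 3) = 2 * k%:R + 1 by rewrite divfK; lra.
have q1 : q <= 1 by rewrite ler_pdivrMr; lra.
have aKk : 0 <= alpha * K%:R * k%:R by rewrite !mulr_ge0 // ltW.
have qK : q * (2 * k%:R + 3) * K%:R = (2 * k%:R + 1) * K%:R by rewrite qE.
move: Kalpha q1 k0 aKk qK; clearbody q; move: (k%:R : R) (K%:R : R) => x y.
lra.
Qed.

(** The Ruzsa-Szemeredi graph on three copies of [V] has at most [#|V| ^ 2] triangles, fewer than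
    [#|V|^-1 * (3 * #|V|) ^ 3]. A larger [delta] would make it triangle-free too cheaply for
    [rs_far]. *)
Lemma delta_triangle_le (R : realType) (eps : R) (d m : nat) :
  (0 < d)%N -> (0 < m)%N -> 0 <= eps ->
  eps * (36 * d%:R * 2 ^+ d) * m%:R ^+ 2 < 1 ->
  delta eps (complete_graph 3) <= ((2 * m%:R) ^+ d)^-1.
Proof.
move=> d0 m0 eps0 small.
have [A apA Am] := exists_ap_free d0 m0.
have [[_ rem] _] := delta_deg_max eps (complete_graph 3) (0 : R).
rewrite -/(delta eps (complete_graph 3)) in rem.
rewrite leNgt; apply/negP => big.
pose V : finZmodType := 'rV['Z_(2 * m)]_d.
have cardV : #|V| = ((2 * m) ^ d)%N.
  by rewrite card_mx mul1n card_ord Zp_cast //; lia.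
have n0 : 0 < #|V|%:R :> R by rewrite cardV ltr0n expn_gt0; lia.
have cardV' : #|V|%:R = (2 * m%:R) ^+ d :> R by rewrite cardV natrX natrM.
rewrite -cardV' in big.
have [||D [/(rs_far apA) VD Deps]] := removal_rel (rs_sym A) (rs_irr A) rem.
- rewrite card_prod card_ord natrM.
  apply: (@le_lt_trans _ _ (#|V|%:R ^+ 2)); first by rewrite -natrX ler_nat card_rs_cliques.
  apply: (@lt_trans _ _ (#|V|%:R^-1 * (3 * #|V|%:R) ^+ 3)).
    rewrite [ltRHS](_ : _ = 27 * #|V|%:R ^+ 2); last by field; rewrite gt_eqF.
    by have : 0 < #|V|%:R ^+ 2 :> R by [rewrite exprn_gt0 |]; lra.
  by rewrite ltr_pM2r // exprn_gt0 // mulr_gt0.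
- by move=> x; rewrite mul0r.
rewrite card_prod card_ord natrM in Deps.
have A0 : (0 < #|A|)%N.
  by case: #|A| Am => //; rewrite muln0 leqn0 expn_eq0; lia.
have {}Am : m%:R ^+ d <= d%:R * m%:R ^+ 2 * #|A|%:R :> R.
  by rewrite -!natrX -!natrM ler_nat.
have {}VD : #|V|%:R * #|A|%:R <= 4 * (eps * (3 * #|V|%:R) ^+ 2) :> R.
  by apply: le_trans Deps; rewrite -natrM ler_nat.
have : #|V|%:R * #|A|%:R < #|V|%:R * #|A|%:R :> R; last by rewrite ltxx.
apply: (le_lt_trans VD).
(* The constant 36 is [4 * 3 ^ 2]. It remains to see [36 * eps * #|V| < #|A|], which follows from
   the density bound [Am] and [small]. *)
have -> : 4 * (eps * (3 * #|V|%:R) ^+ 2) = #|V|%:R * (36 * eps * #|V|%:R) by ring.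
rewrite ltr_pM2l // cardV' exprMn.
apply: (@le_lt_trans _ _ (36 * eps * (2 ^+ d * (d%:R * m%:R ^+ 2 * #|A|%:R)))).
  by rewrite ler_wpM2l ?mulr_ge0 // ler_wpM2l // exprn_ge0.
have -> : 36 * eps * (2 ^+ d * (d%:R * m%:R ^+ 2 * #|A|%:R)) =
  eps * (36 * d%:R * 2 ^+ d) * m%:R ^+ 2 * #|A|%:R by ring.
by rewrite gtr_pMl // ltr0n.
Qed.

Lemma delta_deg_superpolynomial (R : realType) (k : nat) (gamma : R) :
  gamma < (2 * k.+3%:R - 5) / (2 * k.+3%:R - 3) ->
  ~ exists mu : R, 0 < mu /\ forall eps : R, 0 < eps < 1 ->
      mu * eps `^ mu^-1 <= delta_deg eps (complete_graph k.+3) gamma.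
Proof.
rewrite -subr_gt0 => gap; have [C [C0]] := delta_deg_triangle k gap.
rewrite subKr => CP [mu [mu0 muP]].
pose e := (Num.truncn mu^-1).+1.
have mue : mu^-1 <= e%:R by rewrite ltW // truncnS_gt.
(* Along [eps = c / m ^ 2] the assumed lower bound has order [m ^ (- 2 * e)], so one further power
   of [m] in the upper bound contradicts it. *)
pose d := (2 * e + 1)%N.
(* Using 37 where [delta_triangle_le] has 36 turns its strict hypothesis into [36 / 37 < 1]. *)
pose c : R := (C * (37 * d%:R * 2 ^+ d))^-1.
have d0 : 0 < d%:R :> R by rewrite ltr0n /d addn1.
have c0 : 0 < c by rewrite invr_gt0 !mulr_gt0 // exprn_gt0.
have mc0 : 0 < mu * c ^+ e by rewrite mulr_gt0 // exprn_gt0.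
(* The first summand ensures [eps < 1], the second [1 < mu * c ^ e * m]. *)
pose m := (Num.truncn (c + (mu * c ^+ e)^-1)).+1.
have mP : c + (mu * c ^+ e)^-1 < m%:R by exact: truncnS_gt.
have m1 : 1 <= m%:R :> R by rewrite ler1n.
have m0 : 0 < m%:R :> R by rewrite ltr0n.
have m2 : m%:R <= m%:R ^+ 2 :> R by rewrite expr2 ler_peMr // ltW.
have cm : c < m%:R.
  by apply: lt_trans mP; rewrite ltrDl invr_gt0.
have mum : 1 < mu * c ^+ e * m%:R.
  by rewrite -ltr_pdivrMl // mulr1; apply: lt_trans mP; rewrite ltrDr.
pose eps := c / m%:R ^+ 2.
have eps0 : 0 < eps by rewrite divr_gt0 // exprn_gt0.
have eps1 : eps < 1.
  by rewrite ltr_pdivrMr ?exprn_gt0 // mul1r (lt_le_trans cm).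
have upper : delta_deg eps (complete_graph k.+3) gamma <= (m%:R ^+ d)^-1.
  apply: le_trans (CP eps eps0) _.
  apply: (@le_trans _ _ ((2 * m%:R) ^+ d)^-1).
    apply: delta_triangle_le => //.
      by rewrite mulr_ge0 // ltW.
    have -> : C * eps * (36 * d%:R * 2 ^+ d) * m%:R ^+ 2 = 36 / 37.
      rewrite /eps /c; field.
      by rewrite !gt_eqF // exprn_gt0.
    by lra.
  rewrite lef_pV2 ?posrE ?exprn_gt0 ?mulr_gt0 //.
  by rewrite lerXn2r ?nnegrE ?mulr_ge0 ?ltW //; lra.
have lower : mu * eps ^+ e <= (m%:R ^+ d)^-1.
  apply: le_trans upper; apply: le_trans (muP eps _); last by rewrite eps0.
  (* Since [eps <= 1], raising the exponent from [mu^-1] to the integer [e] only lowers the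
     power. *)
  rewrite ler_pM2l // -powR_mulrn ?(ltW eps0) //.
  have eps01 : 0 < eps <= 1 by rewrite eps0 ltW.
  exact: (ger_powR eps01).
have : mu * c ^+ e * m%:R <= 1; last by rewrite leNgt mum.
have -> : mu * c ^+ e * m%:R = mu * eps ^+ e * m%:R ^+ d.
  rewrite /eps /d expr_div_n -exprM exprD expr1; field.
  by rewrite gt_eqF // exprn_gt0.
by rewrite -ler_pdivlMr ?exprn_gt0 // mul1r.
Qed.

Theorem theorem1p3 (R : realType) (r : nat) (hr : (3 <= r)%N) :
  (forall alpha : R, 0 < alpha ->
     exists C : R, 0 < C /\
       forall eps : R, 0 < eps ->
         delta_deg eps (complete_graph r)
             ((2 * r%:R - 5) / (2 * r%:R - 3) - alpha)
           <= delta (C * eps) (complete_graph 3))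
  /\
  (forall gamma : R, gamma < (2 * r%:R - 5) / (2 * r%:R - 3) ->
     ~ exists mu : R, 0 < mu /\
         forall eps : R, 0 < eps < 1 ->
           mu * eps `^ mu^-1 <= delta_deg eps (complete_graph r) gamma).
Proof.
case: r hr => [|[|[|k]]] // _; split=> [alpha|gamma].
  exact: delta_deg_triangle.
exact: delta_deg_superpolynomial.
Qed.
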